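(* Let $k \geq 2$ be an integer and let $\tau = k(k-1)\cdots 21 \in S_k$ be the decreasing permutation of length $k$. For each $n \geq 1$, let $\sigma$ be a permutation chosen uniformly at random from $S_n$ and let $\ell_n^\tau = \ell_n^\tau(\sigma)$ be the length of the longest $\tau$-avoiding subsequence of $\sigma$. Let $p_n^\tau$ be the number of particles (counted over all $k-1$ intervals) in the Hammersley-type particle process described below after $n$ steps. Then $\ell_n^\tau$ and $p_n^\tau$ have the same probability distribution.
   Context: $S_n$ denotes the set of permutations of $[n]=\{1,\dots,n\}$, written in one-line notation $\sigma=\sigma_1\sigma_2\cdots\sigma_n$. For $\tau=\tau_1\cdots\tau_k\in S_k$, a sequence $a_1a_2\cdots a_m$ of distinct numbers contains $\tau$ as a pattern if there are indices $1\le i_1<\dots<i_k\le m$ with $a_{i_s}<a_{i_t}$ if and only if $\tau_s<\tau_t$ for all $1\le s,t\le k$; otherwise it is $\tau$-avoiding. $\ell_n^\tau(\sigma)$ is the maximum length of a subsequence $\sigma_{j_1}\sigma_{j_2}\cdots\sigma_{j_m}$ ($j_1<\dots<j_m$) of $\sigma$ that is $\tau$-avoiding. (For $\tau=21$ this is the length of the longest increasing subsequence.) Particle process: take $k-1$ copies of the unit interval $[0,1]$, labelled $l_1,l_2,\dots,l_{k-1}$. Initially there are no particles. At each step, independently, a point $u$ is chosen uniformly at random in $[0,1]$ and a particle is placed in $l_1$ at position $u_o^1=u$. Simultaneously, the nearest particle in $l_1$ strictly to the right of $u_o^1$ (if any), at position $u_r^1$, is removed from $l_1$ and a particle is placed in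 $l_2$ at position $u_o^2=u_r^1$; then the nearest particle in $l_2$ to the right of $u_o^2$ (if any), at position $u_r^2$, is removed from $l_2$ and a particle is placed in $l_3$ at $u_o^3=u_r^2$; and so on, until the nearest particle in $l_{k-1}$ to the right of $u_o^{k-1}$ (if any) is removed from $l_{k-1}$ and leaves the system. If at some stage there is no particle to the right, the step ends there. $p_n^\tau$ is the total number of particles in $l_1\cup\dots\cup l_{k-1}$ after $n$ steps. *)

(* Defs.v *)
From HB Require Import structures.
From mathcomp Require Import all_boot all_order all_algebra all_fingroup.
From mathcomp Require Import all_classical all_reals all_analysis.
Set Implicit Arguments. Unset Strict Implicit. Unset Printing Implicit Defensive.
Import Order.TTheory GRing.Theory Num.Theory.
Local Open Scope ring_scope.
Local Open Scope classical_set_scope.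

(* A sequence s of distinct numbers contains the pattern t (t given in
   one-line notation) iff some subsequence of s of length size t is
   order-isomorphic to t. *)
Definition pat_contains (s t : seq nat) : bool :=
  [exists m : (size s).-tuple bool,
     let s' := mask m s in
     (size s' == size t) &&
     [forall a : 'I_(size t), forall b : 'I_(size t),
        (nth 0%N s' a < nth 0%N s' b)%N == (nth 0%N t a < nth 0%N t b)%N]].

Definition one_line n (s : 'S_n) : seq nat := [seq (s i).+1 | i <- enum 'I_n].

Definition subseq_at n (s : 'S_n) (A : {set 'I_n}) : seq nat :=
  [seq (s i).+1 | i <- enum A].

Definition ell n (tau : seq nat) (s : 'S_n) : nat :=
  \max_(A : {set 'I_n} | ~~ pat_contains (subseq_at s A) tau) #|A|.

Definition tau_dec (k : nat) : seq nat := rev (iota 1 k).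

Section Particles.
Variable R : realType.

Definition nearest_right (u : R) (l : seq R) : option R :=
  foldr (fun x acc => if u < x then
                        match acc with None => Some x
                                  | Some y => Some (Num.min x y) end
                      else acc) None l.

Definition line_step (l : seq R) (u : R) : seq R * option R :=
  match nearest_right u l with
  | None => (u :: l, None)
  | Some r => (u :: rem r l, Some r)
  end.

Fixpoint lines_step (ls : seq (seq R)) (u : option R) : seq (seq R) :=
  match ls, u with
  | [::], _ => [::]
  | l :: ls', None => l :: ls'
  | l :: ls', Some v => let: (l', o) := line_step l v in l' :: lines_step ls' o
  end.

Definition particle_state (k : nat) (us : seq R) : seq (seq R) :=
  foldl (fun ls u => lines_step ls (Some u)) (nseq k.-1 [::]) us.

Definition particle_count (k : nat) (us : seq R) : nat :=
  sumn (map size (particle_state k us)).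

End Particles.

Definition uniform01 (d : measure_display) (T : measurableType d) (R : realType)
  (P : probability T R) (X : T -> R) : Prop :=
  measurable_fun setT X /\
  forall B : set R, measurable B ->
    P (X @^-1` B) = lebesgue_measure (B `&` `[0, 1]%classic).

Definition mutually_independent (d : measure_display) (T : measurableType d)
  (R : realType) (P : probability T R) (U : nat -> T -> R) : Prop :=
  forall (I : seq nat) (B : nat -> set R), uniq I ->
    (forall i, measurable (B i)) ->
    P (\big[setI/setT]_(i <- I) (U i @^-1` B i)) =
    (\prod_(i <- I) P (U i @^-1` B i))%E.

(* Main.v *)
Require Import Defs.
From HB Require Import structures.
From mathcomp Require Import all_boot all_order all_algebra all_fingroup.
From mathcomp Require Import all_classical all_reals all_analysis.
From mathcomp Require Import measurable_realfun lra.
Import Order.TTheory GRing.Theory Num.Theory.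
Set Implicit Arguments. Unset Strict Implicit. Unset Printing Implicit Defensive.

(* The particle process is row insertion: when the points are distinct, the line
   l_i is the i-th row of the Robinson-Schensted tableau of u_1 ... u_n, so by
   Greene's theorem the number of particles in the first k - 1 lines is the maximal
   size of a union of k - 1 increasing subsequences. Such a union is the same thing
   as a subsequence without decreasing subsequence of length k (color a letter by
   the length of the longest decreasing chain ending there). Greene's theorem is
   proved by moving colorings along Knuth relations from the word to the reading
   word of its tableau, where rows attain the bound and columns show that it is
   optimal.
   For the probabilistic part, cut [0, 1] into N cells: the n points lie in distinct
   cells in a prescribed relative order with probability 'C(N, n) / N ^ n, which
   tends to 1 / n!. Hence every order type has probability at least 1 / n!, so the
   events p_n = m and p_n <> m both have at least the probability claimed; these
   lower bounds add up to 1. *)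

(** * Unions of increasing subsequences as colorings *)

Section Colorings.
Variables (disp : Order.disp_t) (E : orderType disp).
Implicit Types (w p s : seq E) (c : E -> nat) (K : nat).

(* A letter of color at least K is left out: the colors below K cut out of a word
   K disjoint increasing subsequences. *)
Definition incr_rel K c : rel E :=
  fun a b => (c a == c b) && (c a < K)%N ==> (a < b)%O.

Definition colorable K c w := pairwise (incr_rel K c) w.

Definition colored K c w := count (fun x => c x < K)%N w.

(** The coloring itself may change; only the number of colored letters is kept. For every [K] this
    compares the maximal sizes of unions of [K] increasing subsequences. *)
Definition color_le w w' := forall K c, colorable K c w ->
  exists2 c', colorable K c' w' & colored K c w = colored K c' w'.

Lemma colored_cat K c w1 w2 :
  colored K c (w1 ++ w2) = (colored K c w1 + colored K c w2)%N.
Proof. exact: count_cat. Qed.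

Lemma incr_relP K c a b :
  reflect (c a = c b -> (c a < K)%N -> (a < b)%O) (incr_rel K c a b).
Proof.
apply: (iffP implyP) => [h e l|h /andP[/eqP e l]]; last exact: h.
by apply: h; rewrite e eqxx -e l.
Qed.

Lemma colorable0 c w : colorable 0 c w.
Proof.
elim: w => //= a w IH; apply/andP; split=> //.
by apply/allP => b _; apply/incr_relP.
Qed.

Lemma color_le_trans w2 w1 w3 : color_le w1 w2 -> color_le w2 w3 -> color_le w1 w3.
Proof.
move=> h12 h23 K c /h12 [c2 /h23 [c3 h3 e3] e2].
by exists c3 => //; rewrite e2.
Qed.

Lemma colorable_swap K c p s x z :
  incr_rel K c x z -> incr_rel K c z x ->
  colorable K c (p ++ [:: x, z & s]) = colorable K c (p ++ [:: z, x & s]).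
Proof.
move=> xz zx; rewrite /colorable !pairwise_cat /= xz zx /=.
congr (_ && (_ && _)); last by rewrite andbCA.
by rewrite !allrel_consr andbCA.
Qed.

Lemma colored_swap K c p s x z :
  colored K c (p ++ [:: x, z & s]) = colored K c (p ++ [:: z, x & s]).
Proof. by rewrite /colored !count_cat /=; congr (_ + _)%N; rewrite addnCA. Qed.

(** Sorting two neighbours only lifts a constraint, so the same coloring serves. *)
Lemma color_le_sort2 p s x z : (x < z)%O ->
  color_le (p ++ [:: z, x & s]) (p ++ [:: x, z & s]).
Proof.
move=> xz K c h; exists c; last exact: colored_swap.
rewrite colorable_swap //; first by rewrite /incr_rel xz implybT.
by move: h; rewrite /colorable pairwise_cat /= => /and4P[_ _ /andP[-> _] _].
Qed.

Lemma colorable_cat3 K c p s x y z :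
  colorable K c (p ++ [:: x, y, z & s]) <->
  [/\ colorable K c p, colorable K c s,
      {in p & s, forall a b, incr_rel K c a b},
      {in p, forall a, [/\ incr_rel K c a x, incr_rel K c a y & incr_rel K c a z]} &
      [/\ incr_rel K c x y, incr_rel K c x z, incr_rel K c y z &
        {in s, forall b, [/\ incr_rel K c x b, incr_rel K c y b & incr_rel K c z b]}]].
Proof.
rewrite /colorable pairwise_cat /=; split.
  move=> /and5P[/allrelP h -> /and3P[xy xz /allP hx] /andP[yz /allP hy] /andP[/allP hz ->]].
  split=> // [a b ap bs|a ap|]; first by apply: h => //; rewrite !inE bs !orbT.
    by split; apply: h => //; rewrite !inE eqxx ?orbT.
  by split=> // b bs; split; [exact: hx|exact: hy|exact: hz].
move=> [-> -> h hp [-> -> -> hs]] /=; rewrite andbT; apply/and4P; split.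
- apply/allrelP => a b ap; rewrite !inE.
  have [? ? ?] := hp a ap.
  by case/or4P=> [/eqP->|/eqP->|/eqP->|bs] //; apply: h.
- by apply/allP => b /hs[].
- by apply/allP => b /hs[].
- by apply/allP => b /hs[].
Qed.

Lemma eq_in_colorable K c c' w : {in w, c =1 c'} -> colorable K c w = colorable K c' w.
Proof.
move=> h; apply: (eq_in_pairwise (P := mem w)) (allss w) => a b aw bw.
by rewrite /incr_rel (h a aw) (h b bw).
Qed.

Lemma eq_in_colored K c c' w : {in w, c =1 c'} -> colored K c w = colored K c' w.
Proof. by move=> h; apply: eq_in_count => a aw; rewrite /= (h a aw). Qed.

(** * Recoloring across the Knuth relations *)

Definition swap_colors (i j k : nat) := if k == i then j else if k == j then i else k.

Lemma swap_colors_lt K i j k : (i < K)%N -> (j < K)%N ->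
  (swap_colors i j k < K)%N = (k < K)%N.
Proof.
rewrite /swap_colors => iK jK; case: eqP => [->|_]; first by rewrite iK jK.
by case: eqP => [->|]; rewrite ?iK ?jK.
Qed.

Lemma swap_colorsK i j : involutive (swap_colors i j).
Proof.
move=> k; rewrite /swap_colors; case: (eqVneq k i) => [->|ki].
  by rewrite eqxx; case: eqP.
by case: (eqVneq k j) => [->|kj]; rewrite ?eqxx // (negbTE ki) (negbTE kj).
Qed.

Lemma colorable_swap_colors K c i j w : (i < K)%N -> (j < K)%N ->
  colorable K (swap_colors i j \o c) w = colorable K c w.
Proof.
move=> iK jK; apply: eq_pairwise => a b; rewrite /incr_rel /=.
by rewrite (can_eq (@swap_colorsK i j)) swap_colors_lt.
Qed.

Lemma colored_swap_colors K c i j w : (i < K)%N -> (j < K)%N ->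
  colored K (swap_colors i j \o c) w = colored K c w.
Proof. by move=> iK jK; apply: eq_count => a; rewrite /= swap_colors_lt. Qed.

(** Turning the ascent [x z] into a descent can only break a color class that contains both letters;
    this one case is left as a premise. *)
Lemma color_le_swap p s x z : (x < z)%O ->
  (forall K c, colorable K c (p ++ [:: x, z & s]) -> c x = c z -> (c x < K)%N ->
    exists2 c', colorable K c' (p ++ [:: z, x & s])
              & colored K c (p ++ [:: x, z & s]) = colored K c' (p ++ [:: z, x & s])) ->
  color_le (p ++ [:: x, z & s]) (p ++ [:: z, x & s]).
Proof.
move=> xz h K c cw.
have [/andP[/eqP cxz cxK]|ncxz] := boolP ((c x == c z) && (c x < K)%N); first exact: h.
exists c; last exact: colored_swap.
rewrite -colorable_swap //; first by rewrite /incr_rel xz implybT.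
apply/incr_relP => e l; move: ncxz; rewrite -e eqxx.
by rewrite l.
Qed.

Lemma uniq_cat3 p s x y z : uniq (p ++ [:: x, y, z & s]) ->
  [/\ {in p, forall a, [/\ a \notin s, a != x, a != y & a != z]},
      x \notin s, y \notin s & z \notin s].
Proof.
rewrite cat_uniq /= !inE !negb_or => /and5P[_ /and4P[xp yp zp sp]].
move=> /and3P[_ _ xs] /andP[_ ys] /andP[zs _]; split=> // a ap; split.
- by apply: contra sp => as_; apply/hasP; exists a.
- by apply: contraNneq xp => <-.
- by apply: contraNneq yp => <-.
- by apply: contraNneq zp => <-.
Qed.

Lemma colored_cat3 K c p s x y z : colored K c (p ++ [:: x, y, z & s]) =
  (colored K c p + ((c x < K) + (c y < K) + (c z < K) + colored K c s))%N.
Proof. by rewrite /colored count_cat /= !addnA. Qed.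

(* Greene's argument: if x and z carry the same color and y carries another one,
   the tails of the two color classes are exchanged; if y is not colored, it
   replaces x or z. *)
Lemma color_le_knuth1 p s x y z : (x < y < z)%O -> uniq (p ++ [:: y, x, z & s]) ->
  color_le (p ++ [:: y, x, z & s]) (p ++ [:: y, z, x & s]).
Proof.
move=> /andP[xy yz] /uniq_cat3[pN yNs xNs zNs]; have xz := lt_trans xy yz.
rewrite -!(cat_rcons y); apply: color_le_swap => // K c.
rewrite !cat_rcons => cw cxz cxK.
move/colorable_cat3: (cw) => [cp cs cps hp [/incr_relP yx_ _ _ hs]].
have yni : c y <> c x.
  by move=> e; move: (yx_ e); rewrite e => /(_ cxK); rewrite ltNge (ltW xy).
have [yK|Ky] := ltnP (c y) K.
  (* The class of [y] continues with [z] and the old tail of the class of [x]; the class of [x]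
     continues with the old tail of the class of [y], whose letters exceed [y] and hence [x]. *)
  pose c' e := if e \in s then swap_colors (c x) (c y) (c e)
               else if e == z then c y else c e.
  have c'p : {in p, c' =1 c}.
    by move=> a /pN[/negbTE as_ _ _ /negbTE az]; rewrite /c' as_ az.
  have c's : {in s, c' =1 swap_colors (c x) (c y) \o c} by move=> b bs; rewrite /c' bs.
  have c'x : c' x = c x by rewrite /c' (negbTE xNs) (lt_eqF xz).
  have c'y : c' y = c y by rewrite /c' (negbTE yNs) (lt_eqF yz).
  have c'z : c' z = c y by rewrite /c' (negbTE zNs) eqxx.
  exists c'; last first.
    rewrite !colored_cat3 c'x c'y c'z -cxz cxK yK (eq_in_colored _ c'p).
    by rewrite (eq_in_colored _ c's) colored_swap_colors.
  apply/colorable_cat3; rewrite (eq_in_colorable _ c'p) (eq_in_colorable _ c's).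
  rewrite colorable_swap_colors //; split=> // [a b ap bs|a ap|].
  - have [/incr_relP ay /incr_relP ax _] := hp a ap.
    have [/incr_relP yb _ /incr_relP zb] := hs b bs.
    move: (cps a b ap bs) => /incr_relP ab.
    apply/incr_relP; rewrite c'p // c's //= /swap_colors.
    case: eqP => [cb ca aK|_].
      by rewrite (lt_trans (ay ca aK)) // (lt_trans yz) // zb -?cxz.
    case: eqP => [cb ca aK|//].
    by rewrite (lt_trans (ax ca aK)) // (lt_trans xy) // yb.
  - have [/incr_relP ay /incr_relP ax _] := hp a ap.
    split; apply/incr_relP; rewrite c'p ?c'x ?c'y ?c'z // => ca aK.
    by apply: lt_trans (ay ca aK) yz.
  split=> [|||b bs].
  - by apply/incr_relP.
  - by apply/incr_relP; rewrite c'x c'y.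
  - by apply/incr_relP; rewrite c'x c'z.
  have [/incr_relP yb _ /incr_relP zb] := hs b bs.
  split; apply/incr_relP; rewrite ?c'x ?c'y ?c'z c's //= /swap_colors;
    case: eqP => cb; do ?case: eqP => cb'.
  - by move=> *; rewrite (lt_trans yz) // zb -?cxz.
  - by move/yni.
  - by move/esym.
  - by move=> *; rewrite zb -?cxz.
  - by move/yni.
  - by move/esym.
  - by move/esym/yni.
  - by move=> *; rewrite (lt_trans xy) // yb.
  - by move/esym.
(* Here [y] replaces [x]: it stands before [z] and [x < y < z]. *)
pose c' e := if e == x then c y else if e == y then c x else c e.
have c'p : {in p, c' =1 c}.
  by move=> a /pN[_ /negbTE ay /negbTE ax _]; rewrite /c' ay ax.
have c's : {in s, c' =1 c}.
  move=> b bs; rewrite /c'; case: eqP => [bx|_]; first by rewrite -bx bs in xNs.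
  by case: eqP => // bY; rewrite -bY bs in yNs.
have c'x : c' x = c y by rewrite /c' eqxx.
have c'y : c' y = c x by rewrite /c' eqxx (gt_eqF xy).
have c'z : c' z = c x by rewrite /c' (gt_eqF xz) (gt_eqF yz).
exists c'; last first.
  rewrite !colored_cat3 c'x c'y c'z -cxz cxK (ltnNge (c y)) Ky (eq_in_colored _ c'p).
  by rewrite (eq_in_colored _ c's).
apply/colorable_cat3; rewrite (eq_in_colorable _ c'p) (eq_in_colorable _ c's).
split=> // [a b ap bs|a ap|].
- by apply/incr_relP; rewrite c'p // c's //; apply/incr_relP/cps.
- have [/incr_relP ay /incr_relP ax /incr_relP az] := hp a ap.
  split; apply/incr_relP; rewrite c'p ?c'x ?c'y ?c'z // => ca aK.
  + by apply: lt_trans (ax ca aK) xy.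
  + by apply: az => //; rewrite -cxz.
  + by move: aK; rewrite ca ltnNge Ky.
split=> [|||b bs].
- by apply/incr_relP.
- by apply/incr_relP; rewrite c'x c'y => /esym.
- by apply/incr_relP; rewrite c'x c'z => /esym.
have [_ _ /incr_relP zb] := hs b bs.
split; apply/incr_relP; rewrite ?c'x ?c'y ?c'z c's // => cb.
- by move=> *; rewrite (lt_trans yz) // zb -?cxz.
- by move=> *; rewrite zb -?cxz.
- by rewrite ltnNge Ky.
Qed.

(** The same exchange with [y] last: [z] joins the class of [y] and is followed by the old tail of
    the class of [x], while [x], [y] are followed by the old tail of the class of [y]. An uncolored
    [y] replaces [z]. *)
Lemma color_le_knuth2 p s x y z : (x < y < z)%O -> uniq (p ++ [:: x, z, y & s]) ->
  color_le (p ++ [:: x, z, y & s]) (p ++ [:: z, x, y & s]).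
Proof.
move=> /andP[xy yz] /uniq_cat3[pN xNs zNs yNs]; have xz := lt_trans xy yz.
apply: color_le_swap => // K c cw cxz cxK.
move/colorable_cat3: (cw) => [cp cs cps hp [_ _ /incr_relP zy_ hs]].
have yni : c y <> c x.
  by move=> e; move: zy_; rewrite -cxz e => /(_ erefl cxK); rewrite ltNge (ltW yz).
have [yK|Ky] := ltnP (c y) K.
  pose c' e := if e \in s then swap_colors (c x) (c y) (c e)
               else if e == z then c y else if e == y then c x else c e.
  have c'p : {in p, c' =1 c}.
    by move=> a /pN[/negbTE as_ _ /negbTE az /negbTE ay]; rewrite /c' as_ az ay.
  have c's : {in s, c' =1 swap_colors (c x) (c y) \o c} by move=> b bs; rewrite /c' bs.
  have c'x : c' x = c x by rewrite /c' (negbTE xNs) (lt_eqF xz) (lt_eqF xy).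
  have c'y : c' y = c x by rewrite /c' (negbTE yNs) (lt_eqF yz) eqxx.
  have c'z : c' z = c y by rewrite /c' (negbTE zNs) eqxx.
  exists c'; last first.
    rewrite !colored_cat3 c'x c'y c'z -cxz cxK yK (eq_in_colored _ c'p).
    by rewrite (eq_in_colored _ c's) colored_swap_colors.
  apply/colorable_cat3; rewrite (eq_in_colorable _ c'p) (eq_in_colorable _ c's).
  rewrite colorable_swap_colors //; split=> // [a b ap bs|a ap|].
  - have [/incr_relP ax _ /incr_relP ay] := hp a ap.
    have [_ /incr_relP zb /incr_relP yb] := hs b bs.
    move: (cps a b ap bs) => /incr_relP ab.
    apply/incr_relP; rewrite c'p // c's //= /swap_colors.
    case: eqP => [cb ca aK|_].
      by rewrite (lt_trans (ay ca aK)) // (lt_trans yz) // zb -?cxz.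
    case: eqP => [cb ca aK|//].
    by rewrite (lt_trans (ax ca aK)) // (lt_trans xy) // yb.
  - have [/incr_relP ax _ /incr_relP ay] := hp a ap.
    split; apply/incr_relP; rewrite c'p ?c'x ?c'y ?c'z // => ca aK.
      by apply: lt_trans (ay ca aK) yz.
    by apply: lt_trans (ax ca aK) xy.
  split=> [|||b bs].
  - by apply/incr_relP; rewrite c'x c'z.
  - by apply/incr_relP; rewrite c'y c'z.
  - by apply/incr_relP.
  have [_ /incr_relP zb /incr_relP yb] := hs b bs.
  split; apply/incr_relP; rewrite ?c'x ?c'y ?c'z c's //= /swap_colors;
    case: eqP => cb; do ?case: eqP => cb'.
  - by move=> *; rewrite zb -?cxz.
  - by move/yni.
  - by move/esym.
  - by move/esym/yni.
  - by move=> *; rewrite (lt_trans xy) // yb.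
  - by move/esym.
  - by move/esym/yni.
  - by move=> *; rewrite yb.
  - by move/esym.
pose c' e := if e == z then c y else if e == y then c x else c e.
have c'p : {in p, c' =1 c}.
  by move=> a /pN[_ _ /negbTE az /negbTE ay]; rewrite /c' ay az.
have c's : {in s, c' =1 c}.
  move=> b bs; rewrite /c'; case: eqP => [bz|_]; first by rewrite -bz bs in zNs.
  by case: eqP => // bY; rewrite -bY bs in yNs.
have c'x : c' x = c x by rewrite /c' (lt_eqF xz) (lt_eqF xy).
have c'y : c' y = c x by rewrite /c' (lt_eqF yz) eqxx.
have c'z : c' z = c y by rewrite /c' eqxx.
exists c'; last first.
  rewrite !colored_cat3 c'x c'y c'z -cxz cxK (ltnNge (c y)) Ky (eq_in_colored _ c'p).
  by rewrite (eq_in_colored _ c's).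
apply/colorable_cat3; rewrite (eq_in_colorable _ c'p) (eq_in_colorable _ c's).
split=> // [a b ap bs|a ap|].
- by apply/incr_relP; rewrite c'p // c's //; apply/incr_relP/cps.
- have [/incr_relP ax /incr_relP az _] := hp a ap.
  split; apply/incr_relP; rewrite c'p ?c'x ?c'y ?c'z // => ca aK.
  + by move: aK; rewrite ca ltnNge Ky.
  + by apply: lt_trans (ax ca aK) xy.
split=> [|||b bs].
- by apply/incr_relP; rewrite c'x c'z.
- by apply/incr_relP; rewrite c'y c'z.
- by apply/incr_relP.
have [/incr_relP xb /incr_relP zb _] := hs b bs.
split; apply/incr_relP; rewrite ?c'x ?c'y ?c'z c's // => cb.
- by rewrite ltnNge Ky.
- by move=> *; rewrite (lt_trans yz) // zb -?cxz.
Qed.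

(** The quantification over contexts makes this a congruence for concatenation, so that a Knuth
    relation can be applied inside a word. Colors are attached to letters, whence the restriction to
    words without repetition. *)
Definition color_equiv w1 w2 := perm_eq w1 w2 /\
  forall p s, uniq (p ++ w1 ++ s) ->
    color_le (p ++ w1 ++ s) (p ++ w2 ++ s) /\ color_le (p ++ w2 ++ s) (p ++ w1 ++ s).

Lemma color_equiv_refl w : color_equiv w w.
Proof. by split=> // p s _; split=> K c h; exists c. Qed.

Lemma color_equiv_trans w2 w1 w3 :
  color_equiv w1 w2 -> color_equiv w2 w3 -> color_equiv w1 w3.
Proof.
move=> [p12 h12] [p23 h23]; split=> [|p s u]; first exact: perm_trans p23.
have [le12 le21] := h12 p s u.
have [|le23 le32] := h23 p s.
  by rewrite -(perm_uniq (s1 := p ++ w1 ++ s)) // perm_cat2l perm_cat2r.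
by split; apply: color_le_trans; eassumption.
Qed.

Lemma color_equiv_cat p s w1 w2 :
  color_equiv w1 w2 -> color_equiv (p ++ w1 ++ s) (p ++ w2 ++ s).
Proof.
move=> [p12 h12]; split=> [|p' s']; first by rewrite perm_cat2l perm_cat2r.
by rewrite -!catA !(catA p'); apply: h12.
Qed.

Lemma color_equiv_catl p w1 w2 : color_equiv w1 w2 -> color_equiv (p ++ w1) (p ++ w2).
Proof. by move=> /(color_equiv_cat p [::]); rewrite !cats0. Qed.

Lemma color_equiv_catr s w1 w2 : color_equiv w1 w2 -> color_equiv (w1 ++ s) (w2 ++ s).
Proof. exact: (color_equiv_cat [::]). Qed.

(** * Row insertion of one letter by Knuth relations *)

Lemma knuth1_equiv x y z : (x < y < z)%O -> color_equiv [:: y; z; x] [:: y; x; z].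
Proof.
move=> h; have perm_t : perm_eq [:: y; z; x] [:: y; x; z].
  by rewrite perm_cons (perm_catC [:: z] [:: x]).
split=> // p s u; split; last first.
  by apply: color_le_knuth1; rewrite // (perm_uniq (s2 := p ++ [:: y; z; x] ++ s)) //
    perm_cat2l (perm_cat2r s [:: y; x; z]) perm_sym.
by rewrite /= -!(cat_rcons y); apply: color_le_sort2; case/andP: h; apply: lt_trans.
Qed.

Lemma knuth2_equiv x y z : (x < y < z)%O -> color_equiv [:: x; z; y] [:: z; x; y].
Proof.
move=> h; split=> [|p s u]; first by apply/seq.permP => q /=; rewrite addnCA.
split; first exact: color_le_knuth2.
by apply: color_le_sort2; case/andP: h; apply: lt_trans.
Qed.

(** The letter [u] moves left past every letter of [l]; the left neighbour of the exchanged pair is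
    the middle letter of the Knuth relation. *)
Lemma bump_right_equiv r l u : (u < r)%O -> path <%O r l ->
  color_equiv (r :: l ++ [:: u]) [:: r, u & l].
Proof.
elim: l r => [|b l IH] r ur /=; first by move=> _; exact: color_equiv_refl.
move=> /andP[rb bl]; apply: (color_equiv_trans (w2 := [:: r, b, u & l])).
  by apply: (color_equiv_catl [:: r]); apply: IH => //; apply: lt_trans rb.
by apply: (color_equiv_catr l (knuth1_equiv _)); rewrite ur.
Qed.

(** The letter [r] moves left past every letter of [l]; now the right neighbour of the exchanged
    pair is the middle letter. *)
Lemma bump_left_equiv l u r : sorted <%O (rcons l u) -> (u < r)%O ->
  color_equiv (l ++ [:: r; u]) (r :: rcons l u).
Proof.
move=> + ur; elim: l => [|a l IH] /= al; first exact: color_equiv_refl.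
have := IH (path_sorted al) => /(color_equiv_catl [:: a]) /= e.
apply: color_equiv_trans e _.
have: all (< r)%O (rcons l u).
  have := path_sorted al; rewrite (sorted_pairwise lt_trans) pairwise_rcons.
  rewrite all_rcons /= ur => /andP[/allP h _].
  by apply/allP => b /h /= bu; apply: lt_trans ur.
move: al; rewrite headI; set b := head u l; set m := behead _ => /=.
move=> /andP[ab _] /andP[br _].
by apply: (color_equiv_catr m (knuth2_equiv _)); rewrite ab.
Qed.

(** First [u] moves left until it stands right after [r], then [r] moves left out of the row: what
    remains is the bumped letter followed by the new row. *)
Lemma row_insert_equiv l1 l2 u r : sorted <%O (l1 ++ [:: u, r & l2]) ->
  color_equiv (l1 ++ r :: l2 ++ [:: u]) (r :: l1 ++ u :: l2).
Proof.
move=> h; have := h; rewrite -cat_rcons => /cat_sorted2[h1 /= h2].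
have ur : (u < r)%O.
  by move: h => /cat_sorted2[_] /= /andP[].
apply: color_equiv_trans (color_equiv_catl l1 (bump_right_equiv ur h2)) _.
have := color_equiv_catr l2 (bump_left_equiv h1 ur).
by rewrite -catA /= cat_rcons.
Qed.

End Colorings.

(** * Particle lines as rows under Schensted insertion *)

Section Rows.
Variable R : realType.
Implicit Types (l : seq R) (u r : R).

Variant nearest_right_spec u l : option R -> Type :=
| NearestNone of (forall x, x \in l -> (x <= u)%O) : nearest_right_spec u l None
| NearestSome r of r \in l & (u < r)%O & (forall x, x \in l -> (u < x)%O -> (r <= x)%O) :
    nearest_right_spec u l (Some r).

Lemma nearest_rightP u l : nearest_right_spec u l (nearest_right u l).
Proof.
elim: l => [|x l IH] /=; first exact: NearestNone.
case: ltP => xu; last first.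
  case: IH => [h|r rl ur h].
    by apply: NearestNone => y; rewrite inE => /predU1P[->|/h].
  apply: NearestSome => //; first by rewrite inE rl orbT.
  move=> y; rewrite inE => /predU1P[->|/h//].
  by rewrite ltNge xu.
case: IH => [h|r rl ur h].
  apply: NearestSome; rewrite ?mem_head // => y; rewrite inE => /predU1P[->//|/h yu].
  by rewrite ltNge yu.
apply: NearestSome.
- by rewrite /Num.min; case: ifP => _; rewrite inE ?eqxx ?rl ?orbT.
- by rewrite lt_min xu ur.
- move=> y; rewrite inE ge_min => /predU1P[->|yl uy]; first by rewrite lexx.
  by rewrite h ?orbT.
Qed.

(** No element of [l] lies between [u] and [r], because [r] is the nearest one; hence [u] takes the
    place of [r] in the sorted row. *)
Lemma sort_bump u r l : uniq (u :: l) -> r \in l -> (u < r)%O ->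
  (forall x, x \in l -> (u < x)%O -> (r <= x)%O) ->
  exists l1 l2, [/\ sort <=%O l = l1 ++ r :: l2,
    sort <=%O (u :: rem r l) = l1 ++ u :: l2 & sorted <%O (l1 ++ [:: u, r & l2])].
Proof.
move=> /= /andP[ul lU] rl ur rmin.
have rs : r \in sort <=%O l by rewrite mem_sort.
case/splitPr El: _ / rs => [l1 l2]; exists l1, l2.
have pl : perm_eq l (l1 ++ r :: l2) by rewrite -El perm_sym perm_sort.
have srt : sorted <%O (l1 ++ r :: l2).
  by rewrite -El sort_lt_sorted.
have srt' : sorted <%O (l1 ++ [:: u, r & l2]).
  move: srt; rewrite !(sorted_pairwise lt_trans) !pairwise_cat /= ur.
  move=> /and4P[/allrelP h -> rl2 ->]; rewrite rl2 !andbT.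
  have -> : all (> u)%O l2.
    by apply/allP => x /(allP rl2); apply: lt_trans.
  rewrite /= andbT; apply/allrelP => x y xl1; rewrite inE => /predU1P[->|]; last exact: h.
  have xl : x \in l by rewrite (perm_mem pl) mem_cat xl1.
  have xr : (x < r)%O by apply: h => //; rewrite mem_head.
  case: (ltgtP x u) => // [ux|xu]; last by rewrite -xu xl in ul.
  by have := rmin x xl ux; rewrite leNgt xr.
split=> //.
have srt2 : sorted <%O (l1 ++ u :: l2).
  apply: (subseq_sorted lt_trans) srt'; apply: cat_subseq => //=.
  by rewrite eqxx; apply: subseq_cons.
apply: (sorted_eq le_trans le_anti); first exact: sort_le_sorted.
  by move: srt2; rewrite lt_sorted_uniq_le => /andP[].
rewrite perm_sort perm_sym perm_catC /= perm_cons perm_catC perm_sym.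
rewrite -(perm_cons r) -(permPl (perm_to_rem rl)) (permPl pl).
by rewrite perm_catC /= perm_cons perm_catC.
Qed.

Lemma sort_none u l : uniq (u :: l) -> (forall x, x \in l -> (x <= u)%O) ->
  sort <=%O (u :: l) = sort <=%O l ++ [:: u].
Proof.
move=> uu h; apply: (sorted_eq le_trans le_anti); first exact: sort_le_sorted.
  rewrite (sorted_pairwise le_trans) pairwise_cat /= andbT -(sorted_pairwise le_trans).
  rewrite sort_le_sorted andbT; apply/allrelP => x y; rewrite mem_sort => /h xu.
  by rewrite inE => /eqP->.
by rewrite perm_sort perm_sym perm_catC /= perm_cons perm_sort.
Qed.

(* [insert T (Some u)] is a step of the particle process on an unbounded supply
   of lines, the empty ones being left out of [T]. *)
Fixpoint insert (T : seq (seq R)) (o : option R) : seq (seq R) :=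
  match o, T with
  | None, _ => T
  | Some u, [::] => [:: [:: u]]
  | Some u, l :: T' => let: (l', o') := line_step l u in l' :: insert T' o'
  end.

Definition tableau (us : seq R) : seq (seq R) :=
  foldl (fun T u => insert T (Some u)) [::] us.

Lemma insert_None T : insert T None = T. Proof. by case: T. Qed.

(** A line acts only on the lines after it, so cutting off after [K] lines commutes with a step; the
    default [[::]] supplies the lines missing from [T]. *)
Lemma nth_insert_lines T K o :
  lines_step (mkseq (nth [::] T) K) o = mkseq (nth [::] (insert T o)) K.
Proof.
elim: K T o => [|K IH] T [u|]; rewrite ?insert_None //.
have mkseqS T' : mkseq (nth [::] T') K.+1 = nth [::] T' 0 :: mkseq (nth [::] (behead T')) K.
  rewrite /mkseq /= -[1%N]add1n iotaDl -map_comp; congr (_ :: _); apply: eq_map => i /=.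
  by rewrite nth_behead.
rewrite !mkseqS; case: T => [|l T] /=.
  by congr (_ :: _); have := IH [::] None.
case E: (line_step l u) => [l' o]; congr (_ :: _); exact: IH.
Qed.

Lemma particle_state_tableau k us :
  particle_state k us = mkseq (nth [::] (tableau us)) k.-1.
Proof.
rewrite /particle_state /tableau; have -> : nseq k.-1 [::] = mkseq (nth ([::] : seq R) [::]) k.-1.
  by apply: (eq_from_nth (x0 := [::])) => [|i]; rewrite size_nseq ?size_mkseq // => ik;
    rewrite nth_nseq nth_mkseq // ik nth_nil.
suff h T : foldl (fun ls u => lines_step ls (Some u)) (mkseq (nth [::] T) k.-1) us =
    mkseq (nth [::] (foldl (fun T u => insert T (Some u)) T us)) k.-1 by exact: h.
by elim: us T => //= u us IH T; rewrite nth_insert_lines IH.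
Qed.

Lemma particle_count_tableau k us :
  particle_count k us = (\sum_(i < k.-1) size (nth [::] (tableau us) i))%N.
Proof.
rewrite /particle_count particle_state_tableau sumnE big_map big_map.
by rewrite -(big_mkord xpredT (fun i => size (nth [::] (tableau us) i))) /index_iota subn0.
Qed.

(** Last row first. The rows are sorted here because the lines are kept as unordered lists. *)
Fixpoint reading_word (T : seq (seq R)) : seq R :=
  if T is l :: T' then reading_word T' ++ sort <=%O l else [::].

(** Insertion into the first row brings the bumped letter to the end of the word of the later rows,
    where the induction hypothesis takes over. *)
Lemma reading_word_insert T u : uniq (u :: reading_word T) ->
  color_equiv (rcons (reading_word T) u) (reading_word (insert T (Some u))).
Proof.
elim: T u => [|l T IH] u /=; first by move=> _; exact: color_equiv_refl.
rewrite mem_cat cat_uniq negb_or mem_sort sort_uniq => /andP[/andP[uT ul] /and3P[TU Tl lU]].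
have ulU : uniq (u :: l) by rewrite /= ul.
rewrite /line_step; case: nearest_rightP => [h|r rl ur rmin] /=.
  by rewrite insert_None sort_none // catA cats1; exact: color_equiv_refl.
have [l1 [l2 [e1 e2 srt]]] := sort_bump ulU rl ur rmin.
rewrite e1 e2 rcons_cat.
have := color_equiv_catl (reading_word T) (row_insert_equiv srt).
rewrite -cats1 -catA => h; apply: color_equiv_trans h _; rewrite -(cat_rcons r).
apply: color_equiv_catr; apply: IH; rewrite /= TU andbT.
by apply: contra Tl => rT; apply/hasP; exists r; rewrite ?mem_sort.
Qed.

Lemma tableau_rcons us u : tableau (rcons us u) = insert (tableau us) (Some u).
Proof. by rewrite /tableau -cats1 foldl_cat. Qed.

Lemma reading_word_tableau us : uniq us -> color_equiv us (reading_word (tableau us)).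
Proof.
elim/last_ind: us => [|us u IH]; first by move=> _; exact: color_equiv_refl.
rewrite rcons_uniq tableau_rcons => /andP[uus usU]; have e := IH usU.
apply: (color_equiv_trans (w2 := rcons (reading_word (tableau us)) u)).
  by rewrite -!cats1; apply: color_equiv_catr.
have [p _] := e; apply: reading_word_insert.
by rewrite /= -(perm_mem p) -(perm_uniq p) uus.
Qed.

(* For sorted rows this says that the columns of [l] on top of [m] are strictly
   increasing, and that [m] is not longer than [l]. *)
Definition dominates l m := forall x,
  (count (fun b => b <= x)%O m <= count (fun a => a < x)%O l)%N.

Lemma dominates_line_step l m u r l' : dominates l m ->
  line_step l u = (l', Some r) -> dominates l' (line_step m r).1.
Proof.
move=> lm; rewrite /line_step; case: nearest_rightP => // r' rl ur _ [<- er] x.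
move: er rl ur => -> rl ur.
have := lm x; have cl y := seq.permP (perm_to_rem rl) (fun a => a < y)%O.
rewrite cl /= => lmx.
(* The critical case: if [m] has no element in [(r, x]], its count at [x] is its count at [r], and
   the elements of [l] below [r] that bound it survive the removal of [r]. *)
have gap : (forall b, b \in m -> (r < b)%O -> (x < b)%O) -> (r < x)%O ->
    (count (fun b => b <= x)%O m <= count (fun a => a < x)%O (rem r l))%N.
  move=> mgap rx; rewrite (eq_in_count (a2 := fun b => b <= r)%O); last first.
    move=> b bm /=; have [br|rb] := leP b r; first by rewrite (le_trans br (ltW rx)).
    by rewrite leNgt mgap.
  apply: leq_trans (lm r) _; rewrite cl /= ltxx add0n.
  by apply: sub_count => a /= /lt_trans; apply.
case: nearest_rightP => [mr|r2 r2m rr2 r2min] /=; last first.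
  have := seq.permP (perm_to_rem r2m) (fun b => b <= x)%O => /= cm.
  move: lmx gap; rewrite cm; have [r2x|xr2] := leP r2 x => lmx gap.
    have rx := lt_le_trans rr2 r2x; move: lmx.
    by rewrite rx (ltW rx) (lt_trans ur rx).
  have [rx|xr] := ltP r x.
    rewrite (ltW rx) (lt_trans ur rx) leq_add2l; apply: gap => // b bm rb.
    by apply: lt_le_trans xr2 _; exact: r2min.
  move: lmx; rewrite ltNge xr /= !add0n => lmx; rewrite leq_add //.
  by case: (leP r x) => // rx; rewrite (lt_le_trans ur rx).
have [rx|xr] := ltP r x.
  rewrite (ltW rx) (lt_trans ur rx) leq_add2l; apply: gap => // b bm.
  by rewrite ltNge mr.
move: lmx; rewrite ltNge xr /= add0n => lmx; rewrite leq_add //.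
by case: (leP r x) => // rx; rewrite (lt_le_trans ur rx).
Qed.

(** * Tableaux, their columns and the upper bound in Greene's theorem *)

Definition is_tableau (T : seq (seq R)) :=
  forall i, dominates (nth [::] T i) (nth [::] T i.+1).

Lemma is_tableau_insert T o : is_tableau T -> is_tableau (insert T o).
Proof.
elim: T o => [|l T IH] [u|] //=; first by move=> _ [|[|i]] x.
move=> tT; case E: (line_step l u) => [l' o].
have tT' : is_tableau T by move=> i; exact: (tT i.+1).
move=> [|i] /=; last exact: IH.
have lT0 := tT 0%N; rewrite /= in lT0.
case: o E => [r|] E.
  have := dominates_line_step lT0 E.
  by case: (T) => [|m T'] /=; [|case: line_step].
rewrite insert_None => x; apply: leq_trans (lT0 x) _.
by move: E; rewrite /line_step; case: nearest_right => // -[<-] /=; exact: leq_addl.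
Qed.

Lemma is_tableau_tableau us : is_tableau (tableau us).
Proof.
elim/last_ind: us => [|us u IH]; first by move=> i x; rewrite !nth_nil.
by rewrite tableau_rcons; exact: is_tableau_insert.
Qed.

(** In a sorted list the elements below [x] form an initial segment; this turns counts back into
    entries. *)
Lemma nth_lt_count (s : seq R) x j : sorted <=%O s -> (j < count (fun a => a < x)%O s)%N ->
  (j < size s)%N && (nth 0%R s j < x)%O.
Proof.
move=> ss jc; have js : (j < size s)%N by exact: leq_trans jc (count_size _ _).
rewrite js /= ltNge; apply: contraL jc => xj; rewrite -leqNgt -[s](cat_take_drop j).
rewrite count_cat [X in (_ + X)%N](_ : _ = 0%N) ?addn0.
  by apply: leq_trans (count_size _ _) _; rewrite size_take js.
apply/eqP; rewrite -leqn0 leqNgt -has_count; apply/hasPn => a /(nthP 0%R) [i].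
rewrite size_drop nth_drop => ij <-; rewrite -leNgt; apply: le_trans xj _.
by apply: sorted_leq_nth; rewrite ?inE ?leq_addr // -?ltn_subRL //; apply: le_trans.
Qed.

Lemma count_ge_nth (s : seq R) j : sorted <=%O s -> (j < size s)%N ->
  (j < count (fun a => a <= nth 0%R s j)%O s)%N.
Proof.
move=> ss js; rewrite -[X in count _ X](cat_take_drop j.+1) count_cat.
apply: leq_trans (leq_addr _ _); rewrite leq_eqVlt; apply/orP; left.
have -> : j.+1 = size (take j.+1 s) by rewrite size_takel.
rewrite eq_sym size_takel // -[X in _ == X](size_takel js) -all_count.
apply/(all_nthP 0%R) => i; rewrite size_takel // => ij; rewrite nth_take //.
apply: sorted_leq_nth; rewrite ?inE //; [exact: le_trans|exact: leq_ltn_trans js].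
Qed.

Lemma dominates_nth l m j : dominates l m -> (j < size m)%N ->
  (j < size l)%N && (nth 0%R (sort <=%O l) j < nth 0%R (sort <=%O m) j)%O.
Proof.
move=> lm jm; rewrite -(size_sort <=%O l); apply: nth_lt_count; first exact: sort_le_sorted.
rewrite count_sort; apply: leq_trans (lm _); rewrite -(count_sort <=%O _ m).
by apply: count_ge_nth; rewrite ?size_sort // sort_le_sorted.
Qed.

Lemma is_tableau_column T i i' j : is_tableau T -> (i < i')%N ->
  (j < size (nth [::] T i'))%N ->
  (j < size (nth [::] T i))%N &&
  (nth 0%R (sort <=%O (nth [::] T i)) j < nth 0%R (sort <=%O (nth [::] T i')) j)%O.
Proof.
move=> tT; elim: i' => // i' IH; rewrite ltnS leq_eqVlt => /predU1P[->|ii'] ji'.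
  exact: dominates_nth.
have /andP[ji'' lt1] := dominates_nth (tT i') ji'.
by have /andP[-> lt2] := IH ii' ji''; apply: lt_trans lt1.
Qed.

(** Later rows are read first, so [b] precedes [a]. *)
Lemma reading_word_rel T K c i i' a b : colorable K c (reading_word T) -> (i < i')%N ->
  a \in nth [::] T i -> b \in nth [::] T i' -> incr_rel K c b a.
Proof.
elim: T i i' => [|l T IH] i i' /=; first by rewrite nth_nil.
rewrite /colorable pairwise_cat => /and3P[/allrelP h cT _].
case: i' => // i'; case: i => [_|i]; last by rewrite ltnS => *; apply: (IH i i').
move=> /= al bT; apply: h; rewrite ?mem_sort //.
elim: (T) i' bT => [|m T' IHT] [|i'] //= bm; rewrite mem_cat ?mem_sort ?bm ?orbT //.
by rewrite (IHT i').
Qed.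

Lemma colored_reading_word T K c M : (size T <= M)%N ->
  colored K c (reading_word T) = (\sum_(i < M) colored K c (sort <=%O (nth [::] T i)))%N.
Proof.
elim: T M => [|l T IH] [|M] //=; rewrite ?ltnS => TM.
- by rewrite big_ord0.
- by rewrite big1 // => i _; rewrite nth_nil.
- by rewrite big_ord_recl /= colored_cat addnC (IH M).
Qed.

(** The guard [j < size s] gives all rows a common index range [N], so that sums over rows can be
    exchanged with sums over columns. *)
Lemma colored_sum_nth K c (s : seq R) N : (size s <= N)%N ->
  colored K c s = (\sum_(j < N) ((j < size s) && (c (nth 0%R s j) < K)))%N.
Proof.
move=> sN; rewrite /colored -sum1_count (big_nth 0%R) big_mkord.
rewrite big_mkcond (big_ord_widen N (fun j => if (c (nth 0%R s j) < K)%N then 1%N else 0%N)) //.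
by rewrite big_mkcond; apply: eq_bigr => j _; case: (j < _)%N => //=; case: ifP.
Qed.

(** A column is read from its largest entry to its smallest, so no color below [K] occurs in it
    twice. A column of height [h] thus has at most [min(K, h)] colored entries, and these minima add
    up to the size of the first [K] rows. *)
Lemma colored_tableau_le T K c : is_tableau T -> colorable K c (reading_word T) ->
  (colored K c (reading_word T) <= \sum_(i < K) size (nth [::] T i))%N.
Proof.
(* Empty rows pad the tableau to [M >= K] rows; [N] is the length of its first row, which is the
   longest. *)
move=> tT cT; pose M := (size T + K)%N; pose N := size (nth [::] T 0).
have sN i : (size (nth [::] T i) <= N)%N.
  case: i => // i; rewrite leqNgt; apply/negP => Ni.
  by have := is_tableau_column (i := 0%N) tT (ltn0Sn i) Ni; rewrite ltnn.
rewrite (colored_reading_word _ _ (leq_addr K (size T))) -/M.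
under eq_bigr => i _ do rewrite (@colored_sum_nth K c _ N) ?size_sort //.
have -> : (\sum_(i < K) size (nth [::] T i) =
    \sum_(j < N) \sum_(i < K) (j < size (nth [::] T i)))%N.
  rewrite exchange_big; apply: eq_bigr => i _.
  rewrite -[LHS]card_ord -sum1_card (big_ord_widen N (fun=> 1%N)) // big_mkcond.
  by apply: eq_bigr => j _ /=; case: ifP.
rewrite exchange_big; apply: leq_sum => j _.
(* Either column [j] reaches beyond the first [K] rows, and injectivity of the coloring on it gives
   the bound [K], or all its entries lie in those rows. *)
have [|none] := boolP [exists i : 'I_M, (K <= i)%N && (j < size (nth [::] T i))%N].
  move=> /existsP[i0 /andP[Ki0 ji0]].
  have -> : (\sum_(i < K) (j < size (nth [::] T i)) = K)%N.
    rewrite -[RHS]card_ord -sum1_card; apply: eq_bigr => i _.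
    by have /andP[->] := is_tableau_column tT (leq_trans (ltn_ord i) Ki0) ji0.
  pose S := [set i : 'I_M | (j < size (nth [::] T i))%N &&
                            (c (nth 0%R (sort <=%O (nth [::] T i)) j) < K)%N].
  have -> : (\sum_(i < M) ((j < size (nth [::] T i)) &&
      (c (nth 0%R (sort <=%O (nth [::] T i)) j) < K)) = #|S|)%N.
    rewrite -sum1_card [RHS]big_mkcond; apply: eq_bigr => i _.
    by rewrite inE; case: ifP.
  have [K0|/prednK K1] := posnP K.
    by rewrite K0 leqn0 cards_eq0; apply/eqP/setP => i; rewrite !inE K0 andbF.
  pose f (i : 'I_M) : 'I_K.-1.+1 := inord (c (nth 0%R (sort <=%O (nth [::] T i)) j)).
  rewrite -[leqRHS]K1 -[leqRHS]card_ord -(card_in_imset (f := f)) ?max_card //.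
  move=> i1 i2; rewrite !inE => /andP[j1 c1] /andP[j2 c2] /(congr1 val).
  rewrite /f /= !inordK ?K1 // => e; apply/val_inj => /=.
  wlog lt12 : i1 i2 j1 j2 c1 c2 e / (i1 < i2)%N.
    by move=> W; case: (ltngtP i1 i2) => // lt; [exact: W|apply/esym/W].
  have /andP[_] := is_tableau_column tT lt12 j2.
  have /incr_relP/(_ (esym e) c2) : incr_rel K c (nth 0%R (sort <=%O (nth [::] T i2)) j)
      (nth 0%R (sort <=%O (nth [::] T i1)) j).
    by apply: reading_word_rel cT lt12 _ _; rewrite -(mem_sort <=%O) mem_nth ?size_sort.
  by move=> h /lt_trans/(_ h); rewrite ltxx.
rewrite (big_ord_widen M (fun i => nat_of_bool (j < size (nth [::] T i))%N)) ?leq_addl //.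
rewrite [leqRHS]big_mkcond; apply: leq_sum => i _.
case: (ltnP i K) => Ki; first by case: (j < _)%N => //=; exact: leq_b1.
move/existsPn/(_ i): none; rewrite Ki /= => /negbTE ->.
by [].
Qed.

(** * The coloring by rows and Greene's theorem *)

Definition row_color (T : seq (seq R)) (x : R) := find (fun l => x \in l) T.

Lemma row_color_cons l T : uniq (reading_word (l :: T)) ->
  {in reading_word T, row_color (l :: T) =1 succn \o row_color T}.
Proof.
rewrite /= cat_uniq => /and3P[_ h _] x xT; rewrite /row_color /=.
by case: ifPn => // xl; case/hasP: h; exists x; rewrite ?mem_sort.
Qed.

Lemma row_color_cons0 l T : {in sort <=%O l, row_color (l :: T) =1 fun=> 0%N}.
Proof. by move=> x; rewrite /row_color /= mem_sort => ->. Qed.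

(** Distinct rows have distinct colors, and each row is increasing. *)
Lemma colorable_row_color T K : uniq (reading_word T) ->
  colorable K (row_color T) (reading_word T).
Proof.
elim: T K => //= l T IH K lTU; have := lTU; rewrite cat_uniq sort_uniq => /and3P[TU disj lU].
rewrite /colorable pairwise_cat -!/(colorable _ _ _) (eq_in_colorable _ (row_color_cons lTU)).
apply/and3P; split.
- apply/allrelP => x y xT yl; apply/incr_relP.
  by rewrite (row_color_cons lTU) // row_color_cons0.
(* Colors on [T] are shifted by one, so [K.+1] colors on [l :: T] amount to [K] colors on [T]. *)
- case: K => [|K]; first exact: colorable0.
  by have := IH K TU.
- move: lU; rewrite -sort_lt_sorted (sorted_pairwise lt_trans).
  by apply: sub_pairwise => x y xy; apply/incr_relP.
Qed.

Lemma colored_row_color T K : uniq (reading_word T) ->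
  colored K (row_color T) (reading_word T) = (\sum_(i < K) size (nth [::] T i))%N.
Proof.
elim: T K => [|l T IH] K TU; first by rewrite big1 //= => i _; rewrite nth_nil.
rewrite /= colored_cat (eq_in_colored _ (row_color_cons TU)).
rewrite (eq_in_colored _ (@row_color_cons0 l T)).
case: K => [|K]; first by rewrite /colored !count_pred0 big_ord0.
rewrite big_ord_recl /= addnC; congr (_ + _)%N.
  by rewrite /colored (eq_count (a2 := predT)) // count_predT size_sort.
by rewrite -IH //; move: TU; rewrite /= cat_uniq => /andP[].
Qed.

(** The coloring is carried to the reading word of the tableau, where the column bound applies. *)
Lemma Greene_ge k (us : seq R) c : uniq us -> colorable k.-1 c us ->
  (colored k.-1 c us <= particle_count k us)%N.
Proof.
move=> usU cus; have [_ /(_ [::] [::])] := reading_word_tableau usU.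
rewrite !cats0 /= => /(_ usU)[/(_ _ _ cus)[c' c'w ->] _].
rewrite particle_count_tableau; apply: colored_tableau_le c'w.
exact: is_tableau_tableau.
Qed.

(** The row coloring of the reading word is carried back to [us]. *)
Lemma Greene_attained k (us : seq R) : uniq us ->
  exists2 c, colorable k.-1 c us & colored k.-1 c us = particle_count k us.
Proof.
move=> usU; have [p /(_ [::] [::])] := reading_word_tableau usU.
rewrite !cats0 /= => /(_ usU)[_ le].
have TU : uniq (reading_word (tableau us)) by rewrite -(perm_uniq p).
have [c c1 c2] := le _ _ (colorable_row_color k.-1 TU).
by exists c; rewrite // -c2 colored_row_color // particle_count_tableau.
Qed.

End Rows.

(** * Decreasing sets of positions and chain lengths *)

Section DecreasingSets.
Variables (n : nat) (s : 'S_n).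
Implicit Types (A B : {set 'I_n}).

Definition decreasing_on B :=
  [forall i in B, forall j in B, (i < j)%N ==> (s j < s i)%N].

Lemma decreasing_onP B :
  reflect {in B &, forall i j : 'I_n, (i < j)%N -> (s j < s i)%N} (decreasing_on B).
Proof.
apply: (iffP forall_inP) => [h i j iB jB ij|h i iB].
  by move/forall_inP: (h i iB) => /(_ j jB)/implyP; apply.
by apply/forall_inP => j jB; apply/implyP => ij; apply: h.
Qed.

Lemma nth_tau_dec k a : (a < k)%N -> nth 0%N (tau_dec k) a = (k - a)%N.
Proof.
move=> ak; rewrite nth_rev size_iota // nth_iota ?ltn_subrL ?(leq_ltn_trans _ ak) //.
by rewrite add1n subnSK.
Qed.

Lemma ltn_nth_tau_dec k a b : (a < k)%N -> (b < k)%N ->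
  (nth 0%N (tau_dec k) a < nth 0%N (tau_dec k) b)%N = (b < a)%N.
Proof. by move=> ak bk; rewrite !nth_tau_dec // ltn_sub2lE // ltnW. Qed.

Lemma sorted_enum_ord A : sorted (fun i j : 'I_n => i < j)%N (enum A).
Proof.
have tr : transitive (fun i j : 'I_n => i < j)%N by move=> a b c; apply: ltn_trans.
rewrite /(enum A) /enum_mem -enumT; apply: (subseq_sorted tr (filter_subseq _ _)).
 have := iota_ltn_sorted 0 n; rewrite -val_enum_ord.
by rewrite sorted_map.
Qed.

(** Positions are always listed in increasing order, so an occurrence given by a mask and its set of
    positions determine each other. *)
Lemma pat_contains_tau_decP A k :
  reflect (exists B, [/\ B \subset A, decreasing_on B & #|B| = k])
          (pat_contains (subseq_at s A) (tau_dec k)).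
Proof.
have sz_tau : size (tau_dec k) = k by rewrite size_rev size_iota.
have tr : transitive (fun i j : 'I_n => i < j)%N by move=> a b c; apply: ltn_trans.
apply: (iffP existsP) => [[m /andP[/eqP sz /forallP h]]|[B [BA Bd Bk]]].
  have {}h a b : (a < k)%N -> (b < k)%N ->
      (nth 0%N (mask m (subseq_at s A)) a < nth 0%N (mask m (subseq_at s A)) b)%N = (b < a)%N.
    rewrite -{1 2}sz_tau => ak bk.
    have /forallP/(_ (Ordinal bk))/eqP /= -> := h (Ordinal ak).
    by apply: ltn_nth_tau_dec; rewrite -sz_tau.
  move: sz h; rewrite /subseq_at -map_mask sz_tau; set v := mask m (enum A) => sz h.
  have vsub : subseq v (enum A) by apply/mask_subseq.
  have vU : uniq v by apply: subseq_uniq vsub (enum_uniq _).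
  have vs := subseq_sorted tr vsub (sorted_enum_ord A).
  exists [set x in v]; split.
  - by apply/fintype.subsetP => x; rewrite inE => /(mem_subseq vsub); rewrite mem_enum.
  - apply/decreasing_onP => i j; rewrite !inE => iv jv ij.
    rewrite size_map in sz.
    have lt_k x : x \in v -> (index x v < k)%N by rewrite -sz index_mem.
    have := h (index j v) (index i v) (lt_k _ jv) (lt_k _ iv).
    rewrite !(nth_map i) ?index_mem // !nth_index // ltnS => ->.
    rewrite ltnNge; apply/negP => ji.
    move: ji; rewrite leq_eqVlt => /predU1P[e|lt].
      by have := nth_index i jv; rewrite e nth_index // => eij; rewrite eij ltnn in ij.
    have := sorted_ltn_nth tr i vs (index j v) (index i v).
    rewrite !inE !index_mem !nth_index // => /(_ jv iv lt) ji.
    by have := ltn_trans ij ji; rewrite ltnn.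
  - by rewrite cardsE (card_uniqP vU) -sz size_map.
have szm : size (map (mem B) (enum A)) == size (subseq_at s A) by rewrite !size_map.
exists (Tuple szm); rewrite /= /subseq_at -map_mask -filter_mask.
have vs := subseq_sorted tr (filter_subseq (mem B) _) (sorted_enum_ord A).
have szv : size [seq x <- enum A | mem B x] = k.
  rewrite -Bk cardE; apply/perm_size/uniq_perm => [||x].
  - exact/filter_uniq/enum_uniq.
  - exact: enum_uniq.
  - rewrite mem_filter !mem_enum /=; apply/andb_idr; exact: (fintype.subsetP BA).
rewrite size_map szv sz_tau eqxx /=; apply/forallP => a; apply/forallP => b.
have ak := ltn_ord a; have bk := ltn_ord b.
(* A default position for [nth]: since [a < k], the list of [k] positions is not empty. *)
have x0 : 'I_n.
  by case: [seq x <- enum A | mem B x] szv => [/= k0|x _ _ //];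
    have := leq_ltn_trans (leq0n a) ak; rewrite -[X in (_ < X)%N]k0.
rewrite ltn_nth_tau_dec // !(nth_map x0) ?szv // ltnS.
set v := [seq x <- enum A | mem B x] in vs szv *.
have mono i j : (i < j)%N -> (j < k)%N -> (s (nth x0 v j) < s (nth x0 v i))%N.
  move=> ij jk; have ik := ltn_trans ij jk.
  have inB i' : (i' < k)%N -> nth x0 v i' \in B.
    by move=> i'k; have := mem_nth x0 (s := v); rewrite szv => /(_ i' i'k);
      rewrite mem_filter => /andP[].
  move/decreasing_onP: Bd; apply; rewrite ?inB //.
  by apply: (sorted_ltn_nth tr x0 vs); rewrite ?inE ?szv.
apply/eqP; case: (ltngtP a b) => ab.
- by apply/negbTE; rewrite -leqNgt; apply/ltnW/mono.
- exact: mono.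
- by rewrite ab ltnn.
Qed.

(** The position [i] itself is not counted, so the resulting colors start at 0. *)
Definition chain_length A (i : 'I_n) : nat :=
  \max_(B : {set 'I_n} | [&& B \subset A, decreasing_on (i |: B) &
                           [forall j in B, (j < i)%N]]) #|B|.

Lemma chain_length_attained A i : exists B : {set 'I_n}, [/\ B \subset A,
  decreasing_on (i |: B), {in B, forall j : 'I_n, (j < i)%N} & chain_length A i = #|B|].
Proof.
have [|B /and3P[BA Bd /forall_inP Bi] eB] := @eq_bigmax_cond _
    [pred B : {set 'I_n} | [&& B \subset A, decreasing_on (i |: B) &
      [forall j in B, (j < i)%N]]] (fun B : {set 'I_n} => #|B|); last by exists B.
apply/card_gt0P; exists finset.set0; rewrite inE finset.sub0set /=; apply/andP; split.
  by apply/decreasing_onP => a b; rewrite !inE !orbF => /eqP-> /eqP->; rewrite ltnn.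
by apply/forall_inP => j; rewrite inE.
Qed.

Lemma chain_length_lt A k i : i \in A ->
  ~~ pat_contains (subseq_at s A) (tau_dec k.+1) -> (chain_length A i < k)%N.
Proof.
move=> iA; apply: contraNT; rewrite -leqNgt => kc; apply/pat_contains_tau_decP.
have [B [BA Bd Bi eB]] := chain_length_attained A i.
have : (k < #|i |: B|)%N.
  rewrite cardsU1 (_ : i \notin B) ?add1n ?ltnS -?eB //.
  by apply/negP => /Bi; rewrite ltnn.
(* The chain may have more than [k + 1] elements; any [k + 1] of them form the pattern. *)
case/card_geqP => v [vU sz vB]; exists [set x in v].
have vB' : [set x in v] \subset i |: B by apply/fintype.subsetP => x; rewrite inE => /vB.
split; last by rewrite cardsE (card_uniqP vU).
  by apply: fintype.subset_trans vB' _; rewrite finset.subUset finset.sub1set iA.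
move/decreasing_onP: Bd => Bd; apply/decreasing_onP => a b av bv.
by apply: Bd; apply: (fintype.subsetP vB').
Qed.

(** A longest chain before [i], extended by [i], is a chain before [j]. Hence positions of [A] with
    equal chain length carry increasing values. *)
Lemma chain_length_decr A (i j : 'I_n) : i \in A -> (i < j)%N -> (s j < s i)%N ->
  (chain_length A i < chain_length A j)%N.
Proof.
move=> iA ij sji.
have [B [BA /decreasing_onP Bd Bi eB]] := chain_length_attained A i.
have -> : (chain_length A i).+1 = #|i |: B|.
  rewrite cardsU1 (_ : i \notin B) ?add1n -?eB //.
  by apply/negP => /Bi; rewrite ltnn.
have Bj b : b \in i |: B -> (b < j)%N /\ (s j < s b)%N.
  rewrite !inE => /predU1P[->//|bB]; have bi := Bi b bB; split; first exact: ltn_trans ij.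
  by apply: ltn_trans sji _; apply: Bd => //; rewrite !inE ?eqxx ?bB ?orbT.
apply: (leq_bigmax_cond (i |: B)); apply/and3P; split.
- by rewrite finset.subUset finset.sub1set iA.
- apply/decreasing_onP => a b; rewrite in_setU1 [b \in _]in_setU1.
  move=> /predU1P[->|aB] /predU1P[->|bB].
  + by rewrite ltnn.
  + by move=> jb; have [bj _] := Bj b bB; have := ltn_trans jb bj; rewrite ltnn.
  + by move=> _; have [] := Bj a aB.
  + exact: Bd.
- by apply/forall_inP => b /Bj[].
Qed.

End DecreasingSets.

(** * Equality of [ell] and the particle count for points in the order of [s] *)

Section EllParticles.
Variables (R : realType) (n : nat) (s : 'S_n) (u : 'I_n -> R).
Hypothesis us : forall i j, (u i < u j)%R = (s i < s j)%N.

Let u_inj : injective u.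
Proof.
move=> i j e; apply: (perm_inj (s := s)); apply/val_inj => /=.
by case: (ltngtP (s i) (s j)) => //; rewrite -us e ltxx.
Qed.

Let pairwise_enum (r : rel 'I_n) : (forall i j : 'I_n, (i < j)%N -> r i j) ->
  pairwise r (enum 'I_n).
Proof.
move=> h; have tr : transitive (fun i j : 'I_n => i < j)%N by move=> a b c; apply: ltn_trans.
have := sorted_enum_ord [set: 'I_n]%SET; rewrite enum_setT -enumT (sorted_pairwise tr).
by apply: (@sub_pairwise _ (fun i j : 'I_n => i < j)%N r) => i j; exact: h.
Qed.

(** For one inequality an avoiding set is colored by chain length; for the other, the colored
    positions of an optimal coloring avoid the pattern by the pigeonhole principle. *)
Lemma ell_particle_count k : (0 < k)%N ->
  ell (tau_dec k) s = particle_count k [seq u i | i <- enum 'I_n].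
Proof.
case: k => // k _.
have uU : uniq [seq u i | i <- enum 'I_n] by rewrite map_inj_uniq ?enum_uniq.
apply/eqP; rewrite eqn_leq; apply/andP; split.
  apply/bigmax_leqP => A avoid.
  (* Positions outside [A] get the color [k], which means that they are left out. *)
  pose c x := if [pick i | u i == x] is Some i then
                if i \in A then chain_length s A i else k else k.
  have cE i : c (u i) = if i \in A then chain_length s A i else k.
    rewrite /c; case: pickP => [j /eqP/u_inj->//|/(_ i)]; by rewrite eqxx.
  have : colorable k c [seq u i | i <- enum 'I_n].
    rewrite /colorable pairwise_map; apply: pairwise_enum => i j ij.
    apply/incr_relP; rewrite !cE; case: ifPn => iA; last by rewrite ltnn.
    case: ifPn => jA; last by move=> ->; rewrite ltnn.
    move=> e _; rewrite us ltnNge; apply/negP; rewrite leq_eqVlt => /predU1P[e'|lt].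
      by move: ij; rewrite (perm_inj (val_inj e')) ltnn.
    by have := chain_length_decr iA ij lt; rewrite e ltnn.
  move=> /(Greene_ge (k := k.+1) uU) /=; apply: leq_trans.
  rewrite /colored count_map -size_filter cardE; apply: uniq_leq_size; first exact: enum_uniq.
  move=> i; rewrite mem_enum mem_filter mem_enum /= cE => iA; rewrite iA andbT.
  exact: chain_length_lt.
have [c cc <-] := Greene_attained k.+1 uU; rewrite /= in cc *.
pose A := [set i | (c (u i) < k)%N].
have -> : colored k c [seq u i | i <- enum 'I_n] = #|A|.
  rewrite /colored count_map -size_filter cardE; apply/perm_size/uniq_perm => [||i].
  - exact/filter_uniq/enum_uniq.
  - exact: enum_uniq.
  - by rewrite mem_filter !mem_enum /A !inE /= andbT.
apply: (leq_bigmax_cond A); apply/negP.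
move=> /pat_contains_tau_decP[B [/fintype.subsetP BA /decreasing_onP Bd Bk]].
have [k0|/prednK kK] := posnP k.
  have : (0 < #|B|)%N by rewrite Bk.
  by case/card_gt0P => i /BA; rewrite inE k0.
(* Two positions of [B] with one color would be both an ascent and a descent, so [f] injects [k + 1]
   positions into [k] colors. *)
pose f i : 'I_k.-1.+1 := inord (c (u i)).
suff f_inj : {in B &, injective f}.
  by have := max_card (mem (f @: B)); rewrite card_in_imset // Bk card_ord kK ltnn.
move=> i j iB jB /(congr1 val); have := BA i iB; have := BA j jB; rewrite !inE => cj ci.
rewrite /f /= !inordK ?kK // => e; apply/val_inj => /=.
wlog ij : i j iB jB ci cj e / (i < j)%N.
  by move=> W; case: (ltngtP i j) => // lt; [exact: W|apply/esym/W].
have := Bd i j iB jB ij.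
have : incr_rel k c (u i) (u j).
  move: cc; rewrite /colorable pairwise_map => /(pairwiseP i) /(_ i j).
  by rewrite !inE size_enum_ord !ltn_ord !nth_ord_enum; apply.
by move/incr_relP => /(_ e ci); rewrite us => /ltn_trans h /h; rewrite ltnn.
Qed.

End EllParticles.

(** * Invariance of the particle count under increasing relabelling *)

Section OrderType.
Variables (R : realType) (D : {pred R}) (f : R -> R).
Hypothesis f_mono : {in D &, forall x y, (f x < f y)%R = (x < y)%R}.
Implicit Types (l : seq R) (u r : R).

Let f_inj : {in D &, injective f}.
Proof.
move=> x y xD yD e; have := f_mono xD yD; have := f_mono yD xD.
by rewrite e ltxx; case: ltgtP.
Qed.

Lemma nearest_right_map u l : u \in D -> {subset l <= D} ->
  nearest_right (f u) (map f l) = omap f (nearest_right u l).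
Proof.
move=> uD; elim: l => //= x l IH lD.
have xD : x \in D by apply: lD; rewrite mem_head.
have {}lD : {subset l <= D} by move=> y yl; apply: lD; rewrite inE yl orbT.
rewrite f_mono // IH //; case: ltP => // _.
case: nearest_rightP => //= r rl _ _; rewrite /Num.min /Order.min (f_mono xD (lD r rl)).
by case: ltP.
Qed.

Lemma rem_map_in r l : r \in D -> {subset l <= D} -> rem (f r) (map f l) = map f (rem r l).
Proof.
move=> rD; elim: l => //= x l IH lD.
have xD : x \in D by apply: lD; rewrite mem_head.
rewrite (inj_in_eq f_inj) //; case: eqP => //= _; rewrite IH // => y yl.
by apply: lD; rewrite inE yl orbT.
Qed.

Lemma lines_step_map (ls : seq (seq R)) (o : option R) :
  (forall l, l \in ls -> {subset l <= D}) -> (forall u, o = Some u -> u \in D) ->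
  lines_step (map (map f) ls) (omap f o) = map (map f) (lines_step ls o) /\
  (forall l, l \in lines_step ls o -> {subset l <= D}).
Proof.
elim: ls o => [|l ls IH] [u|] //= lsD oD.
have uD := oD u erefl; have lD : {subset l <= D} by apply: lsD; rewrite mem_head.
have {}lsD l' : l' \in ls -> {subset l' <= D} by move=> h; apply: lsD; rewrite inE h orbT.
rewrite /line_step nearest_right_map //; case: nearest_rightP => [h|r rl ur h] /=.
  have [|e1 e2] := IH None lsD; first by [].
  rewrite /= in e1; rewrite e1; split=> // l'; rewrite inE => /predU1P[->|/e2//] x.
  by rewrite inE => /predU1P[->|/lD].
have [|e1 e2] := IH (Some r) lsD; first by move=> _ [<-]; exact: lD.
rewrite /= in e1; rewrite e1 rem_map_in ?lD //; split=> // l'; rewrite inE => /predU1P[->|/e2//] x.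
by rewrite inE => /predU1P[->|/mem_rem/lD].
Qed.

Lemma particle_count_map k us : {subset us <= D} ->
  particle_count k (map f us) = particle_count k us.
Proof.
move=> usD; rewrite /particle_count.
suff -> : particle_state k (map f us) = map (map f) (particle_state k us).
  by rewrite -map_comp; congr sumn; apply: eq_map => l /=; rewrite size_map.
pose step (ls : seq (seq R)) u := lines_step ls (Some u).
suff h (ls : seq (seq R)) : (forall l, l \in ls -> {subset l <= D}) ->
    foldl step (map (map f) ls) (map f us) = map (map f) (foldl step ls us).
  rewrite /particle_state -h ?map_nseq // => l.
  by rewrite mem_nseq => /andP[_ /eqP->].
elim: us ls usD => //= u us IH ls usD lsD.
have [|e1 e2] := @lines_step_map ls (Some u) lsD.
  by move=> _ [<-]; apply: usD; rewrite mem_head.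
rewrite /= in e1; rewrite /step e1 IH // => x xus; apply: usD; by rewrite inE xus orbT.
Qed.

End OrderType.

(* Ties are allowed: this gives the measurability of the particle count. *)
Lemma eq_order_particle_count (R : realType) k n (us vs : nat -> R) :
  (forall i j : 'I_n, (us i < us j)%R = (vs i < vs j)%R) ->
  particle_count k [seq us i | i <- iota 0 n] = particle_count k [seq vs i | i <- iota 0 n].
Proof.
(* A value goes to the [vs] of its first index. Under ties this is harmless: equal [us] force equal
   [vs], since neither is smaller. *)
move=> uv; pose f x := vs (index x [seq us i | i <- iota 0 n]).
have uvN i j : (i < n)%N -> (j < n)%N -> (us i < us j)%R = (vs i < vs j)%R.
  by move=> lti ltj; exact: (uv (Ordinal lti) (Ordinal ltj)).
have idx x : x \in [seq us i | i <- iota 0 n] ->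
    (index x [seq us i | i <- iota 0 n] < n)%N /\
    us (index x [seq us i | i <- iota 0 n]) = x.
  move=> xus; have := xus; rewrite -index_mem size_map size_iota => lt; split=> //.
  by have := nth_index 0%R xus; rewrite (nth_map 0%N) ?size_iota // nth_iota.
have f_mono : {in [seq us i | i <- iota 0 n] &, forall x y, (f x < f y)%R = (x < y)%R}.
  by move=> x y /idx[ltx ex] /idx[lty ey]; rewrite /f -uvN // ex ey.
rewrite -(particle_count_map (f := f) (D := mem [seq us i | i <- iota 0 n]) f_mono) //.
congr particle_count; rewrite -map_comp; apply/eq_in_map => i.
rewrite mem_iota add0n => /= lti.
have ius : us i \in [seq us i | i <- iota 0 n] by apply: map_f; rewrite mem_iota.
have [ltj ej] := idx _ ius; rewrite /= /f.
set j := index _ _ in ltj ej *.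
by case: (ltgtP (vs j) (vs i)) => //; rewrite -uvN // ej ltxx.
Qed.

(** * Numerical and measure-theoretic lower bounds *)

Local Open Scope ring_scope.
Local Open Scope classical_set_scope.

Lemma le_bernoulli (R : realFieldType) (x : R) n : 0 <= x <= 1 ->
  1 - n%:R * x <= (1 - x) ^+ n.
Proof.
move=> /andP[x0 x1]; elim: n => [|n IH]; first by rewrite mul0r subr0 expr0.
rewrite exprS; apply: le_trans (ler_wpM2l _ IH); last by rewrite subr_ge0.
rewrite -natr1; have := ler0n R n; nra.
Qed.

Lemma leq_expn_ffact N n : ((N - n) ^ n <= N ^_ n)%N.
Proof.
elim: n N => [|n IH] [|N]; rewrite ?ffactn0 ?expn0 //.
  by rewrite sub0n exp0n.
rewrite ffactnS /= subSS expnS leq_mul //.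
by apply: leq_trans (leq_subr _ _) _.
Qed.

(** Additivity over disjoint events; it serves both for choices of cells and for order types of
    permutations. *)
Lemma measure_ge_card (d : measure_display) (T : measurableType d) (R : realType)
  (P : probability T R) (I : finType) (Q : {pred I}) (F : I -> set T) (A : set T) (p : R) :
  measurable A -> (forall i, i \in Q -> measurable (F i)) ->
  (forall i, i \in Q -> F i `<=` A) ->
  {in Q &, forall i j w, F i w -> F j w -> i = j} ->
  (forall i, i \in Q -> (p%:E <= P (F i))%E) ->
  ((#|Q|%:R * p)%:E <= P A)%E.
Proof.
move=> mA mF FA Fdisj pF.
suff h r : uniq r -> {subset r <= Q} ->
    (((size r)%:R * p)%:E <= P (\big[setU/set0]_(i <- r) F i))%E.
  rewrite cardE; apply: le_trans (h _ (enum_uniq _) _) _; first by move=> i; rewrite mem_enum.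
  apply: le_measure; rewrite ?inE //.
    rewrite big_seq; apply: bigsetU_measurable => i; rewrite mem_enum; exact: mF.
  by rewrite -bigcup_seq => w [i /=]; rewrite mem_enum => /FA; apply.
elim: r => [|i r IH] /=; first by move=> _ _; rewrite mul0r.
move=> /andP[ir rU] rQ; have iQ : i \in Q by apply: rQ; rewrite mem_head.
have {}rQ : {subset r <= Q} by move=> j jr; apply: rQ; rewrite inE jr orbT.
rewrite big_cons measureU; last first.
- apply/seteqP; split=> // w [/= Fi]; rewrite -bigcup_seq => -[j /= jr Fj].
  by move: ir; rewrite (Fdisj i j iQ (rQ j jr) w Fi Fj) jr.
- by rewrite big_seq; apply: bigsetU_measurable => j /rQ; exact: mF.
- exact: mF.
by rewrite -natr1 mulrDl mul1r addrC EFinD; apply: leeD; [exact: pF|exact: IH].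
Qed.

(* Bernoulli's inequality bounds the ratio of 'C(N, n) n! to N ^ n from below
   by 1 - n ^ 2 / N. *)
Lemma invf_fact_le (R : realType) n (p : R) :
  (forall N, (0 < N)%N -> 'C(N, n)%:R * N%:R ^- n <= p) -> n`!%:R^-1 <= p.
Proof.
move=> hp; have f0 : 0 < n`!%:R :> R by rewrite ltr0n fact_gt0.
rewrite -[_^-1]mul1r ler_pdivrMr // leNgt; apply/negP => lt1.
(* If the claim fails by a gap [e > 0], then [N >= n] is taken so large that [n ^ 2 / N < e],
   against Bernoulli's bound. *)
set e := 1 - p * n`!%:R; have e0 : 0 < e by rewrite subr_gt0.
pose N := (n + (Num.truncn (n%:R ^+ 2 / e)).+1)%N.
have N0 : (0 < N)%N by rewrite /N addnS.
have NR : 0 < N%:R :> R by rewrite ltr0n.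
have nN : (n <= N)%N by rewrite leq_addr.
have lt2 : n%:R ^+ 2 < N%:R * e.
  rewrite -ltr_pdivrMr //; apply: lt_le_trans (truncnS_gt _) _.
  by rewrite ler_nat leq_addl.
have := hp N N0; rewrite ler_pdivrMr ?exprn_gt0 // => le1.
have le2 : (N - n)%:R ^+ n <= p * n`!%:R * N%:R ^+ n.
  apply: le_trans (_ : (N ^_ n)%:R <= _).
    by rewrite -natrX ler_nat leq_expn_ffact.
  rewrite -bin_ffact natrM mulrAC ler_pM2r //.
have le3 : 1 - n%:R * (n%:R / N%:R) <= p * n`!%:R.
  have h : 0 <= (n%:R / N%:R : R) <= 1.
    by rewrite divr_ge0 ?ler0n //= ler_pdivrMr // mul1r ler_nat.
  apply: le_trans (le_bernoulli n h) _.
  rewrite -(ler_pM2r (exprn_gt0 n NR)) -exprMn mulrBl mul1r divfK ?gt_eqF //.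
  by rewrite -natrB.
have : n%:R * (n%:R / N%:R) < e.
  by rewrite mulrA -expr2 ltr_pdivrMr // mulrC.
rewrite /e; lra.
Qed.

(** Half-open, so that a point determines its cell. *)
Definition cell (R : realType) (N j : nat) : set R := `[j%:R / N%:R, j.+1%:R / N%:R[.
Arguments cell : clear implicits.

Lemma cellP (R : realType) N j (x : R) : (0 < N)%N ->
  cell R N j x <-> j%:R <= x * N%:R < j.+1%:R.
Proof.
move=> N0; have NR : 0 < N%:R :> R by rewrite ltr0n.
by rewrite /cell /= in_itv /= ler_pdivrMr // ltr_pdivlMr.
Qed.

(** * Order types of independent uniform points *)

Section OrderEvents.
Variables (R : realType) (d : measure_display) (T : measurableType d).
Variables (P : probability T R) (U : nat -> T -> R) (n : nat).
Hypothesis HU : forall i, uniform01 P (U i).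
Hypothesis Hind : mutually_independent P U.

Definition order_event (b : 'I_n -> 'I_n -> bool) : set T :=
  [set w | forall i j : 'I_n, (U i w < U j w) = b i j].

Lemma measurable_order_event b : measurable (order_event b).
Proof.
have -> : order_event b = \bigcap_(p in [set: 'I_n * 'I_n])
    ((fun w => U p.1 w < U p.2 w) @^-1` [set b p.1 p.2]).
  by apply/seteqP; split=> [w h [i j] _|w h i j]; [exact: h|exact: (h (i, j))].
apply: fin_bigcap_measurable => [|p _]; first exact: finite_finset.
rewrite -[X in measurable X]setTI.
by apply: measurable_fun_ltr => //; have [] := HU p.1; have [] := HU p.2.
Qed.

(** The count depends only on the finitely many comparisons between points, so the event is a finite
    union of order events. *)
Lemma measurable_particle_count k m :
  measurable [set w | particle_count k [seq U i w | i <- iota 0 n] = m].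
Proof.
set F := [set w | _].
pose pat w : {ffun 'I_n * 'I_n -> bool} := [ffun p : 'I_n * 'I_n => U p.1 w < U p.2 w].
have -> : F = \bigcup_(b in pat @` F) order_event (fun i j => b (i, j)).
  apply/seteqP; split=> [w Fw|w [_ [w' Fw' <-]] ww'].
    by exists (pat w) => [|i j]; [exists w|rewrite ffunE].
  rewrite /F /= -Fw'; apply: eq_order_particle_count => i j.
  by rewrite ww' ffunE.
apply: fin_bigcup_measurable => [|b _]; last exact: measurable_order_event.
exact: finite_finset.
Qed.

Lemma probability_cell i N j : (j < N)%N -> P (U i @^-1` cell R N j) = (N%:R^-1)%:E.
Proof.
move=> jN; have N0 := leq_ltn_trans (leq0n j) jN.
have NR : 0 < N%:R :> R by rewrite ltr0n.
have [_ ->] := HU i; last exact: measurable_itv.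
rewrite setIidl => [|x /(cellP _ _ N0)/andP[x0 x1]]; last first.
  rewrite /= in_itv /=; apply/andP; split.
    by rewrite -(pmulr_lge0 _ NR) (le_trans (ler0n _ _) x0).
  rewrite -(ler_pM2r NR) mul1r (le_trans (ltW x1)) // ler_nat.
  by [].
rewrite lebesgue_measure_itv /= lte_fin ltr_pM2r ?invr_gt0 // ltr_nat ltnSn.
by rewrite -EFinB -mulrBl -natr1 addrAC subrr add0r mul1r.
Qed.

(** Recovers [s] from the comparisons of its values; order events of different permutations are
    therefore disjoint. *)
Lemma perm_rank (s : 'S_n) i : (s i : nat) = (\sum_(j < n | (s j < s i)%N) 1)%N.
Proof.
rewrite -[LHS]card_ord -sum1_card (big_ord_widen n (fun=> 1%N)) 1?ltnW //.
by rewrite (reindex_inj (perm_inj (s := s))).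
Qed.

Lemma perm_event_disjoint (s s' : 'S_n) w :
  order_event (fun i j => (s i < s j)%N) w ->
  order_event (fun i j => (s' i < s' j)%N) w -> s = s'.
Proof.
move=> h h'; apply/permP => i; apply/val_inj; rewrite /= (perm_rank s) (perm_rank s').
by apply: eq_bigl => j; rewrite -h -h'.
Qed.

Variable s : 'S_n.

(** For each strictly increasing tuple [t] of cells, placing [U i] in cell [t (s i)] for all [i]
    realizes the order of [s]. There are ['C(N, n)] such tuples, and by independence each has
    probability [N ^- n]. *)
Lemma perm_event_ge : ((n`!%:R^-1)%:E <= P (order_event (fun i j => (s i < s j)%N)))%E.
Proof.
set E := order_event _; have mE : measurable E by exact: measurable_order_event.
rewrite -(fineK (fin_num_measure P E mE)) lee_fin; apply: invf_fact_le => N N0.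
rewrite -lee_fin fineK ?fin_num_measure // -card_ltn_sorted_tuples.
(* Independence is stated for families indexed by [nat]; indices from [n] on get the default cell 0,
   which does not enter the intersection [F t]. *)
pose g (t : n.-tuple 'I_N) (i : nat) : nat := if insub i is Some o then tnth t (s o) else 0%N.
have gE t (i : 'I_n) : g t i = tnth t (s i).
  by rewrite /g insubT // => lti; congr (val (tnth t (s _))); apply/val_inj.
have gN t i : (g t i < N)%N by rewrite /g; case: insubP.
pose F t := \big[setI/setT]_(i <- iota 0 n) (U i @^-1` cell R N (g t i)).
have FP t w : F t w -> forall i : 'I_n, (tnth t (s i))%:R <= U i w * N%:R < (tnth t (s i)).+1%:R.
  rewrite /F -bigcap_seq => Fw i; rewrite -gE; apply/cellP => //.
  by apply: Fw; rewrite /= mem_iota add0n ltn_ord.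
apply: (@measure_ge_card _ _ _ _ _ _ F) => // [t _|t|t t' _ _ w /FP h /FP h'|t _].
- rewrite /F -bigcap_seq; apply: fin_bigcap_measurable => [|i _]; first exact: finite_seq.
  by rewrite -[X in measurable X]setTI; have [mU _] := HU i; apply: mU => //; exact: measurable_itv.
- rewrite inE => ts w /FP h.
  have lt_ij i j : (s i < s j)%N -> U i w < U j w.
    move=> sij; have /andP[_ hi] := h i; have /andP[hj _] := h j.
    have NR : 0 < N%:R :> R by rewrite ltr0n.
    rewrite -(ltr_pM2r NR) (lt_le_trans hi) // (le_trans _ hj) // ler_nat.
    have := sorted_ltn_nth ltn_trans 0%N ts (s i) (s j).
    rewrite !inE size_map size_tuple !ltn_ord => /(_ isT isT sij).
    by rewrite !(nth_map (tnth t (s i))) ?size_tuple // -!tnth_nth.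
  move=> i j; case: (ltngtP (s i) (s j)) => [/lt_ij->//|/lt_ij h'|/val_inj/perm_inj ->].
    by rewrite ltNge (ltW h').
  by rewrite ltxx.
(* A point lying in two cells forces each of their indices to be at most the other. *)
- apply: eq_from_tnth => o; apply/val_inj => /=; have := h (s^-1%g o); have := h' (s^-1%g o).
  rewrite !permKV => /andP[h1 h2] /andP[h3 h4].
  have := le_lt_trans h1 h4; have := le_lt_trans h3 h2; rewrite !ltr_nat !ltnS => a b.
  by apply/eqP; rewrite eqn_leq a b.
- rewrite /F Hind ?iota_uniq //; last by move=> i; exact: measurable_itv.
  rewrite (eq_bigr (fun=> (N%:R^-1)%:E)) => [|i _]; last exact: probability_cell.
  have := prodr_const_nat 0 n (N%:R^-1 : R); rewrite /index_iota subn0 prodEFin => ->.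
  by rewrite exprVn.
Qed.

End OrderEvents.

(* For k >= 2, tau = k(k-1)...1, n >= 1, sigma uniform in S_n, and
   U_0, U_1, ... i.i.d. uniform on [0,1] (the points chosen at the
   successive steps): for every m,
   P(ell_n^tau(sigma) = m) = P(p_n^tau = m). *)
Theorem theorem2p1 (R : realType) (d : measure_display) (T : measurableType d)
  (P : probability T R) (U : nat -> T -> R)
  (HU : forall i, uniform01 P (U i)) (Hind : mutually_independent P U)
  (k n : nat) (hk : (2 <= k)%N) (hn : (1 <= n)%N) (m : nat) :
  ((#|[pred s : 'S_n | ell (tau_dec k) s == m]|%:R / (n`!)%:R : R)%:E =
   P [set w | particle_count k [seq U i w | i <- iota 0 n] = m])%E.
Proof.
set F := [set w | _]; set Q := [pred s : 'S_n | _].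
pose E (s : 'S_n) := order_event U (fun i j : 'I_n => (s i < s j)%N).
have mF : measurable F by exact: measurable_particle_count.
have mE s : measurable (E s) by exact: measurable_order_event.
have ellE s w : E s w -> ell (tau_dec k) s = particle_count k [seq U i w | i <- iota 0 n].
  move=> Ew; rewrite -val_enum_ord -map_comp.
  by apply: (@ell_particle_count R n s (fun i => U i w)); rewrite // (leq_trans _ hk).
have le1 : ((#|Q|%:R / n`!%:R)%:E <= P F)%E.
  apply: (@measure_ge_card _ _ _ _ _ _ E) => // [s /eqP sQ w /ellE e|s s' _ _ w|s _].
  - by rewrite /F /= -e.
  - exact: perm_event_disjoint.
  - exact: perm_event_ge.
have le2 : ((#|[predC Q]|%:R / n`!%:R)%:E <= P (~` F))%E.
  apply: (@measure_ge_card _ _ _ _ _ _ E) => // [|s sQ w /ellE e|s s' _ _ w|s _].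
  - exact: measurableC.
  - by move=> Fw; move: sQ; rewrite !inE e Fw eqxx.
  - exact: perm_event_disjoint.
  - exact: perm_event_ge.
have PF := fin_num_measure P F mF.
rewrite probability_setC // -(fineK PF) -EFinB lee_fin in le2.
rewrite -(fineK PF) lee_fin in le1.
rewrite -(fineK PF); congr EFin; apply/le_anti; rewrite le1 /=.
(* The lower bounds for [F] and its complement add up to 1, which forces equality in both. *)
have : #|Q|%:R / n`!%:R + #|[predC Q]|%:R / n`!%:R = 1 :> R.
  rewrite -mulrDl -natrD cardC card_Sn divff // pnatr_eq0 -lt0n fact_gt0 //.
lra.
Qed.
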